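(* Let $(x,\lambda):[0,+\infty)\to G\times\mathbb{R}^p$ be a solution of the saddle-point-like dynamics $$\text{(SPLD)}\qquad \dot x\in P_{T_G(x)}(F(x,\lambda)),\qquad\dot\lambda=h(x),$$ starting from $(x_0,\lambda_0)\in G\times\mathbb{R}^p$. Then there exists $\kappa>0$ such that $(x,\lambda)$ is also a solution of the saddle-point dynamics $$\text{(SPD)}\qquad \dot x\in-\partial_xL(x,\lambda),\qquad\dot\lambda=h(x),$$ where $L(x,\lambda)=f(x)+\frac{1}{2\mu}\lVert h(x)\rVert^2+\langle\lambda,h(x)\rangle+\kappa\sum_{k=1}^m\max\{0,g_k(x)\}$.
   Context: Setting: the convex program $\min\{f(x)\mid h(x)=0_p,\ g(x)\le0_m\}$, where $f:\mathbb{R}^n\to\mathbb{R}$ is convex, $g=(g_1,\dots,g_m):\mathbb{R}^n\to\mathbb{R}^m$ is (componentwise) convex, neither necessarily differentiable, and $h(x)=Ax-b$ with $A\in\mathbb{R}^{p\times n}$, $b\in\mathbb{R}^p$, $p\le n$. Let $C=\{x\mid h(x)=0_p,\ g(x)\le0_m\}$. Standing assumptions: the solution set $S=\{x^\star\in C\mid f(x^\star)=\inf_Cf\}$ is nonempty and bounded; (A1) $\mathrm{rank}(A)=p$; (A2) there is $x\in\mathbb{R}^n$ with $h(x)=0_p$ and $g_k(x)<0$ for all $k$. The parameter $\mu>0$ is fixed. $G=\{x\in\mathbb{R}^n\mid g(x)\le0_m\}$ (closed and convex). The set-valued map $F:G\times\mathbb{R}^p\rightrightarrows\mathbb{R}^n$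 is $$F(x,\lambda)=-\tfrac1\mu A^\top(Ax-b)-A^\top\lambda-\partial f(x),$$ with $\partial f$ the convex subdifferential. $\partial_xL(x,\lambda)$ is the subdifferential of the convex function $L(\cdot,\lambda)$ at $x$. For $x\in G$ and a nonempty convex compact set $K\subset\mathbb{R}^n$, $$P_{T_G(x)}(K)=\bigcup_{\xi\in K}\lim_{\delta\searrow0}\frac{\mathrm{proj}_G(x+\delta\xi)-x}{\delta},$$ where $\mathrm{proj}_G$ is the Euclidean projection onto $G$; equivalently, it is the set of Euclidean projections of elements of $K$ onto the tangent cone $T_G(x)=\mathrm{cl}\,\mathbb{R}_{\ge0}(G-x)$. A solution of either dynamics is a (locally) absolutely continuous curve satisfying the inclusion for almost every $t$ (with values in $G\times\mathbb{R}^p$ in the case of (SPLD)). *)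

(* Defs.v *)
From HB Require Import structures.
From mathcomp Require Import all_boot all_order all_algebra.
From mathcomp Require Import all_classical all_reals all_analysis.

Set Implicit Arguments.
Unset Strict Implicit.
Unset Printing Implicit Defensive.

Import Order.TTheory GRing.Theory Num.Theory.
Import numFieldNormedType.Exports.

Local Open Scope classical_set_scope.
Local Open Scope ring_scope.

(* R^n is 'cV[R]_n. The library norm `|x| on matrices is the sup norm, so the
   Euclidean structure is introduced separately; the sup norm is used only for
   topological notions (limits, boundedness, absolute continuity). *)
Definition dotv (R : realType) (n : nat) (u v : 'cV[R]_n) : R :=
  \sum_(i < n) u i ord0 * v i ord0.

Definition enorm (R : realType) (n : nat) (u : 'cV[R]_n) : R :=
  Num.sqrt (dotv u u).

Definition eq_constr (R : realType) (n p : nat) (A : 'M[R]_(p, n))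
  (b : 'cV[R]_p) (x : 'cV[R]_n) : 'cV[R]_p := A *m x - b.

Definition ineq_set (R : realType) (n m : nat) (g : 'cV[R]_n -> 'cV[R]_m) :
  set 'cV[R]_n := [set x | forall k : 'I_m, g x k ord0 <= 0].

Definition feasible_set (R : realType) (n m p : nat)
  (g : 'cV[R]_n -> 'cV[R]_m) (h : 'cV[R]_n -> 'cV[R]_p) : set 'cV[R]_n :=
  [set x | h x = 0] `&` ineq_set g.

(* The infimum is taken in the extended reals because the real-valued [inf] is
   a default value on sets that are not bounded below. *)
Definition solution_set (R : realType) (n : nat) (f : 'cV[R]_n -> R)
  (C : set 'cV[R]_n) : set 'cV[R]_n :=
  [set x | C x /\ (f x)%:E = ereal_inf [set (f y)%:E | y in C]].

Definition subdifferential (R : realType) (n : nat) (f : 'cV[R]_n -> R)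
  (x : 'cV[R]_n) : set 'cV[R]_n :=
  [set xi | forall y, f x + dotv xi (y - x) <= f y].

(* Meaningful for G nonempty, closed and convex, when the minimizer exists and
   is unique; xget picks it. *)
Definition eproj (R : realType) (n : nat) (G : set 'cV[R]_n) (y : 'cV[R]_n) :
  'cV[R]_n :=
  xget 0 [set q | G q /\ forall z, G z -> enorm (y - q) <= enorm (y - z)].

Definition tangent_proj (R : realType) (n : nat) (G : set 'cV[R]_n)
  (x : 'cV[R]_n) (K : set 'cV[R]_n) : set 'cV[R]_n :=
  [set v | exists2 xi, K xi &
    d^-1 *: (eproj G (x + d *: xi) - x) @[d --> 0^'+] --> v].

Definition F_field (R : realType) (n p : nat) (f : 'cV[R]_n -> R)
  (A : 'M[R]_(p, n)) (b : 'cV[R]_p) (mu : R)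
  (x : 'cV[R]_n) (lam : 'cV[R]_p) : set 'cV[R]_n :=
  [set - (mu^-1 *: (A^T *m (A *m x - b))) - A^T *m lam - xi
    | xi in subdifferential f x].

Definition lagrangian (R : realType) (n m p : nat) (f : 'cV[R]_n -> R)
  (g : 'cV[R]_n -> 'cV[R]_m) (h : 'cV[R]_n -> 'cV[R]_p) (mu kappa : R)
  (x : 'cV[R]_n) (lam : 'cV[R]_p) : R :=
  f x + (2 * mu)^-1 * enorm (h x) ^+ 2 + dotv lam (h x)
  + kappa * \sum_(k < m) Num.max 0 (g x k ord0).

Definition abs_continuous_on (R : realType) (V : normedModType R) (a b : R)
  (c : R -> V) : Prop :=
  forall e : R, 0 < e -> exists2 d : R, 0 < d &
    forall (N : nat) (u v : 'I_N -> R),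
      (forall i, [/\ a <= u i, u i <= v i & v i <= b]) ->
      trivIset setT (fun i => `]u i, v i[%classic) ->
      \sum_(i < N) (v i - u i) < d ->
      \sum_(i < N) `|c (v i) - c (u i)| < e.

(* Curves on [0, +oo[ are functions on R whose values at t < 0 are ignored. *)
Definition loc_abs_continuous (R : realType) (V : normedModType R)
  (c : R -> V) : Prop :=
  forall T : R, 0 <= T -> abs_continuous_on 0 T c.

(* x' \in Phi(x, lam), lam' = h(x) for almost every t in [0, +oo[; the null
   point t = 0 is left out as only a one-sided derivative makes sense there. *)
Definition dyn_solution (R : realType) (n p : nat)
  (Phi : 'cV[R]_n -> 'cV[R]_p -> set 'cV[R]_n) (h : 'cV[R]_n -> 'cV[R]_p)
  (x : R -> 'cV[R]_n) (lam : R -> 'cV[R]_p) : Prop :=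
  [/\ loc_abs_continuous x, loc_abs_continuous lam &
      {ae @lebesgue_measure R, forall t : R, 0 < t ->
        (exists2 v, is_derive t 1 x v & Phi (x t) (lam t) v) /\
        is_derive t 1 lam (h (x t))}].

Definition spld_solution (R : realType) (n m p : nat) (f : 'cV[R]_n -> R)
  (g : 'cV[R]_n -> 'cV[R]_m) (A : 'M[R]_(p, n)) (b : 'cV[R]_p) (mu : R)
  (x : R -> 'cV[R]_n) (lam : R -> 'cV[R]_p) : Prop :=
  (forall t : R, 0 <= t -> ineq_set g (x t)) /\
  dyn_solution
    (fun y l => tangent_proj (ineq_set g) y (F_field f A b mu y l))
    (eq_constr A b) x lam.

Definition spd_solution (R : realType) (n m p : nat) (f : 'cV[R]_n -> R)
  (g : 'cV[R]_n -> 'cV[R]_m) (A : 'M[R]_(p, n)) (b : 'cV[R]_p) (mu kappa : R)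
  (x : R -> 'cV[R]_n) (lam : R -> 'cV[R]_p) : Prop :=
  dyn_solution
    (fun y l => [set - xi | xi in
       subdifferential
         (fun z => lagrangian f g (eq_constr A b) mu kappa z l) y])
    (eq_constr A b) x lam.

(* Main.v *)
Require Import Defs.
From HB Require Import structures.
From mathcomp Require Import all_boot all_order all_algebra.
From mathcomp Require Import all_classical all_reals all_analysis.
From mathcomp Require Import measurable_realfun ring lra.

Import Order.TTheory GRing.Theory Num.Theory.
Import numFieldNormedType.Exports.

Local Open Scope classical_set_scope.
Local Open Scope ring_scope.

Set Implicit Arguments.
Unset Strict Implicit.

(** Write G for the set of inequality-feasible points and h x = A x - b. The
    velocity v of the projected dynamics at x is the tangential part of some
    field value xi = - (1/mu) A^T h(x) - A^T lam - w, where w is a subgradient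
    of f at x, and what the projection removes, eta = xi - v, is an outward
    normal of G at x. Hence - v = (1/mu) A^T h(x) + A^T lam + w + eta, and the
    first three terms form a subgradient of the smooth-plus-f part of L. The
    claim therefore reduces to showing that eta is a subgradient at x of
    kappa * sum_k max(0, g_k), with one kappa that serves for all times.

    Exact penalization. Let z satisfy g_k z <= - s < 0 for every k. An
    arbitrary y, whose total violation is P y, enters G when it is moved toward
    z to the point t y + (1 - t) z with t = s / (s + P y) ([slater_pull]).
    Testing the normal eta on this point gives
    <eta, y - x> <= (P y / s) <eta, x - z>, so that every kappa above
    <eta, x - z> / s is large enough ([slater_exact_penalty]).

    Uniformity in time. Since |eta| <= |xi| ([tangent_proj_normal]), one kappa
    works for all times once x and lam stay bounded, because convex functions
    have bounded subgradients on bounded sets ([subgradient_bounded]).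
    Boundedness comes from the Lyapunov function |x - xs|^2 + |lam - ls|^2,
    where xs is a minimizer and ls a Lagrange multiplier of the equality
    constraints, that is, f xs <= f y + <ls, h y> for all y in G. Its derivative
    is nonpositive by convexity, the saddle inequality and <eta, xs - x> <= 0
    ([spld_dissipation], [spld_bounded]).

    Three tools are needed on the way. The multiplier is built one equality
    constraint at a time ([lagrange_multiplier]), each coordinate being the
    supremum of a set of slopes.
    Projections onto G exist because convex sublevel sets are closed
    ([convex_sublevel_closed]), and the limit of difference quotients that
    defines v inherits the variational inequality of the projection. Finally an
    absolutely continuous function whose derivative is almost everywhere
    nonpositive is nonincreasing ([abs_continuous_nonincreasing]). *)

(** * Euclidean inner product and sup norm *)

Section Euclid.
Context {R : realType} {n : nat}.
Implicit Types u v w : 'cV[R]_n.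

Lemma dotvC u v : dotv u v = dotv v u.
Proof. by apply: eq_bigr => i _; rewrite mulrC. Qed.

Lemma dotvDl u v w : dotv (u + v) w = dotv u w + dotv v w.
Proof. by rewrite -big_split; apply: eq_bigr => i _; rewrite mxE mulrDl. Qed.

Lemma dotvZl (a : R) u v : dotv (a *: u) v = a * dotv u v.
Proof. by rewrite mulr_sumr; apply: eq_bigr => i _; rewrite mxE mulrA. Qed.

Lemma dotvNl u v : dotv (- u) v = - dotv u v.
Proof. by rewrite -scaleN1r dotvZl mulN1r. Qed.

Lemma dotvDr u v w : dotv w (u + v) = dotv w u + dotv w v.
Proof. by rewrite dotvC dotvDl !(dotvC w). Qed.

Lemma dotvZr (a : R) u v : dotv v (a *: u) = a * dotv v u.
Proof. by rewrite dotvC dotvZl (dotvC v). Qed.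

Lemma dotvNr u v : dotv v (- u) = - dotv v u.
Proof. by rewrite dotvC dotvNl (dotvC v). Qed.

Lemma dotv0r u : dotv u 0 = 0.
Proof. by rewrite -(scale0r u) dotvZr mul0r. Qed.

Lemma dotv_delta u i : dotv (delta_mx i ord0) u = u i ord0.
Proof.
rewrite /dotv (bigD1 i)//= mxE !eqxx mul1r big1 ?addr0// => j ji.
by rewrite mxE (negPf ji) mul0r.
Qed.

Lemma dotvv_ge0 u : 0 <= dotv u u.
Proof. by apply: sumr_ge0 => i _; rewrite -expr2 sqr_ge0. Qed.

Lemma enorm_sqr u : enorm u ^+ 2 = dotv u u.
Proof. by rewrite sqr_sqrtr ?dotvv_ge0. Qed.

Lemma ler_enorm u v : (enorm u <= enorm v) = (dotv u u <= dotv v v).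
Proof. by rewrite ler_sqrt ?dotvv_ge0. Qed.

Definition dotvE := (dotvDl, dotvDr, dotvNl, dotvNr, dotvZl, dotvZr).

Lemma dotv_le_mean u v : 2 * dotv u v <= dotv u u + dotv v v.
Proof.
have := dotvv_ge0 (u - v); rewrite !dotvE (dotvC v u); lra.
Qed.

End Euclid.

Lemma dotv_mulmx {R : realType} {n p : nat} (A : 'M[R]_(p, n)) (u : 'cV[R]_p)
    (v : 'cV[R]_n) :
  dotv (A^T *m u) v = dotv u (A *m v).
Proof.
transitivity (\sum_i \sum_j A j i * u j ord0 * v i ord0).
  apply: eq_bigr => i _; rewrite mxE mulr_suml.
  by apply: eq_bigr => j _; rewrite mxE.
rewrite exchange_big; apply: eq_bigr => j _ /=; rewrite mxE mulr_sumr.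
by apply: eq_bigr => i _; rewrite mulrCA mulrA.
Qed.

Lemma coord_le_norm {R : realType} {n : nat} (u : 'cV[R]_n) i :
  `|u i ord0| <= `|u|.
Proof.
rewrite [leRHS]/Num.Def.normr/= mx_normrE.
exact: (le_bigmax _ (fun ij : 'I_n * 'I_1 => `|u ij.1 ij.2|) (i, ord0)).
Qed.

Lemma norm_le_coord {R : realType} {n : nat} (u : 'cV[R]_n) (M : R) :
  0 <= M -> (forall i, `|u i ord0| <= M) -> `|u| <= M.
Proof.
move=> M0 uM; rewrite [leLHS]/Num.Def.normr/= mx_normrE.
by apply: bigmax_le => // -[i j] _ /=; rewrite ord1.
Qed.

(** Together with [dotv_le_sqr_norm] below: the Euclidean structure carries the
    estimates and the sup norm the topology, and these two lemmas are the only
    passages between them. *)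
Lemma sqr_norm_le_dotv {R : realType} {n : nat} (u : 'cV[R]_n) (M : R) :
  0 <= M -> dotv u u <= M ^+ 2 -> `|u| <= M.
Proof.
move=> M0 uM; apply: norm_le_coord => // i.
rewrite -(ler_pXn2r (n := 2)) ?nnegrE// real_normK ?num_real//.
apply: le_trans uM; rewrite /dotv (bigD1 i)//= -expr2 lerDl.
by apply: sumr_ge0 => j _; rewrite -expr2 sqr_ge0.
Qed.

Lemma dotv_le_sqr_norm {R : realType} {n : nat} (u : 'cV[R]_n) :
  dotv u u <= n%:R * `|u| ^+ 2.
Proof.
have -> : n%:R * `|u| ^+ 2 = \sum_(i < n) `|u| ^+ 2.
  by rewrite sumr_const card_ord mulr_natl.
apply: ler_sum => i _; rewrite -expr2 -real_normK ?num_real//.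
by rewrite ler_pXn2r ?nnegrE// coord_le_norm.
Qed.

Lemma mulmx_norm_le {R : realType} {n p : nat} (A : 'M[R]_(p, n)) :
  exists2 K : R, 0 <= K & forall u : 'cV[R]_n, `|A *m u| <= K * `|u|.
Proof.
exists (\sum_i \sum_j `|A i j|).
  by apply: sumr_ge0 => i _; apply: sumr_ge0.
move=> u; apply: norm_le_coord => [|i].
  by rewrite mulr_ge0//; apply: sumr_ge0 => i _; apply: sumr_ge0.
rewrite mxE; apply: (le_trans (ler_norm_sum _ _ _)).
rewrite (bigD1 i)//= mulrDl mulr_suml ler_wpDr//.
  by rewrite mulr_ge0//; apply: sumr_ge0 => k _; apply: sumr_ge0.
by apply: ler_sum => j _; rewrite normrM ler_wpM2l// coord_le_norm.
Qed.

(** * Convex functions on bounded sets *)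
Section ConvexFunctions.
Context {R : realType} {n : nat}.
Implicit Types (f : 'cV[R]_n -> R) (x y z : 'cV[R]_n).

Lemma convex_functionP f (t : R) x y : convex_function setT f ->
  0 <= t -> t <= 1 -> f (t *: x + (1 - t) *: y) <= t * f x + (1 - t) * f y.
Proof.
move=> cf t0 t1.
have t01 : Itv.spec (@Itv.num_sem R) (Itv.Real `[0%Z, 1%Z]) t.
  by rewrite /Itv.num_sem/= num_real/= in_itv/= t0 t1.
by have := cf (Itv.mk t01) x y (in_setT _) (in_setT _).
Qed.

Lemma convex_segment_bound f (r c : R) x : convex_function setT f ->
  0 < r -> `|c| <= r -> f (c *: x) <= `|f (r *: x)| + `|f (- r *: x)|.
Proof.
move=> cf r0; rewrite ler_norml => /andP[rc cr].
pose t := (r + c) / (2 * r).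
have t0 : 0 <= t by rewrite divr_ge0; lra.
have t1 : t <= 1 by rewrite ler_pdivrMr; lra.
have := convex_functionP (r *: x) (- r *: x) cf t0 t1.
rewrite !scalerA -scalerDl (_ : t * r + (1 - t) * - r = c); last first.
  rewrite /t; field; lra.
move=> /le_trans; apply; apply: lerD.
  apply: (le_trans (ler_wpM2l t0 (ler_norm _))).
  by rewrite ler_piMl.
apply: (le_trans (ler_wpM2l _ (ler_norm _))); first lra.
by rewrite ler_piMl//; lra.
Qed.

(** By induction on the number k of coordinates allowed to be nonzero: x is the
    midpoint of twice its part on the first k coordinates and twice its part on
    coordinate k, and on a line a convex function is bounded by its values at
    the two ends of a segment. *)
Lemma convex_ubound f (r : R) : convex_function setT f ->
  exists M : R, forall x, `|x| <= r -> f x <= M.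
Proof.
move=> cf.
suff H (k : nat) (s : R) : 0 < s -> exists M : R, forall x,
    (forall i : 'I_n, `|x i ord0| <= s) ->
    (forall i : 'I_n, (k <= i)%N -> x i ord0 = 0) -> f x <= M.
  have [|M HM] := H n (`|r| + 1).
    by rewrite ltr_wpDl.
  exists M => x xr; apply: HM => i; last by rewrite leqNgt ltn_ord.
  rewrite (le_trans (coord_le_norm _ _))// (le_trans xr)//.
  by rewrite (le_trans (ler_norm _))// lerDl.
elim: k s => [|k IH] s s0.
  exists (f 0) => x _ x0; suff -> : x = 0 by [].
  by apply/colP => i; rewrite x0// mxE.
have [|M HM] := IH (2 * s); first lra.
have [kn|nk] := ltnP k n; last first.
  exists M => x xs xk; apply: HM => i.
    by rewrite (le_trans (xs i))//; lra.
  by rewrite leqNgt (leq_trans (ltn_ord i) nk).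
pose e : 'cV[R]_n := delta_mx (Ordinal kn) ord0.
exists (2^-1 * M + 2^-1 * (`|f (2 * s *: e)| + `|f (- (2 * s) *: e)|)).
move=> x xs xk.
pose x' : 'cV[R]_n := \col_i (if i == Ordinal kn then 0 else x i ord0).
have -> : x = 2^-1 *: (2 *: x') + (1 - 2^-1) *: (2 * x (Ordinal kn) ord0 *: e).
  apply/colP => i; rewrite !mxE eqxx andbT.
  by have [->|_] := eqVneq; rewrite /=; field.
apply: (le_trans (convex_functionP _ _ cf _ _)); [lra|lra|].
rewrite (_ : 1 - 2^-1 = 2^-1); last lra.
apply: lerD; rewrite ler_pM2l ?invr_gt0//.
  apply: HM => i; rewrite !mxE.
    case: ifP => _; first by rewrite mulr0 normr0; lra.
    by rewrite normrM ger0_norm// ler_pM2l.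
  move=> ki; case: eqVneq => [|ik]; first by rewrite mulr0.
  by rewrite xk ?mulr0// ltn_neqAle ki andbT eq_sym; apply: contra ik.
apply: convex_segment_bound => //; first lra.
by rewrite normrM ger0_norm// ler_pM2l.
Qed.

(** The value at the midpoint 0 of x and - x turns an upper bound at - x into a
    lower bound at x. *)
Lemma convex_lbound f (r : R) : convex_function setT f ->
  exists M : R, forall x, `|x| <= r -> M <= f x.
Proof.
move=> cf; have [M HM] := convex_ubound r cf.
exists (2 * f 0 - M) => x xr.
have h0 : (0 : R) <= 2^-1 by lra.
have h1 : 2^-1 <= 1 :> R by lra.
have := convex_functionP x (- x) cf h0 h1.
rewrite (_ : 1 - 2^-1 = 2^-1 :> R); last lra.
rewrite -scalerDr subrr scaler0.
by have := HM (- x); rewrite normrN => /(_ xr); lra.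
Qed.

(** Moving from x by one unit along a coordinate axis, in either direction,
    raises f by at least the matching coordinate of the subgradient, and this
    rise is at most the oscillation of f on the ball of radius r + 1. *)
Lemma subgradient_bounded f (r : R) : convex_function setT f ->
  exists2 K : R, 0 <= K & forall x xi, `|x| <= r -> subdifferential f x xi ->
    `|xi| <= K.
Proof.
move=> cf; have [M HM] := convex_ubound (r + 1) cf.
have [m Hm] := convex_lbound r cf.
exists (Num.max 0 (M - m)); first by rewrite le_max lexx.
move=> x xi xr xif; apply: norm_le_coord; first by rewrite le_max lexx.
move=> i; rewrite le_max; apply/orP; right.
pose e : 'cV[R]_n := delta_mx i ord0.
have e1 : `|e| <= 1.
  apply: norm_le_coord => // j; rewrite mxE.
  by case: eqP; rewrite ?normr1 ?normr0.
have xie : dotv xi e = xi i ord0 by rewrite dotvC dotv_delta.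
have fm := Hm _ xr.
have He (s : R) : `|s| = 1 -> s * xi i ord0 <= M - m.
  move=> s1; have := xif (x + s *: e).
  rewrite [x + _ - x]addrC addKr dotvZr xie => H.
  have : f (x + s *: e) <= M.
    apply: HM; rewrite (le_trans (ler_normD _ _))// lerD//.
    by rewrite normrZ s1 mul1r.
  by lra.
by rewrite ler_norml; have := He 1; have := He (-1);
  rewrite normrN normr1 => /(_ erefl) + /(_ erefl); lra.
Qed.

(** If f x > 0 while f y <= 0 for some y at distance at most e from x, then x
    lies between y and z = x + (x - y) / e. The point z stays in a fixed ball,
    where f is bounded, and its weight e / (1 + e) is as small as desired. *)
Lemma convex_sublevel_closed f : convex_function setT f ->
  closed [set x | f x <= 0].
Proof.
move=> cf x clx /=; rewrite leNgt; apply/negP => fx.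
have [M HM] := convex_ubound (`|x| + 1) cf.
pose e := Num.min 1 (f x / (2 * (`|M| + 1))).
have M1 : 0 < `|M| + 1 by rewrite ltr_wpDl.
have e0 : 0 < e by rewrite lt_min ltr01 divr_gt0//; lra.
have [y [/= fy]] := clx _ (nbhsx_ballx x e e0).
rewrite -ball_normE /= => xy.
pose z := x + e^-1 *: (x - y).
have fz : f z <= M.
  apply: HM; rewrite (le_trans (ler_normD _ _))// lerD//.
  by rewrite normrZ gtr0_norm ?invr_gt0// mulrC ler_pdivrMr// mul1r ltW.
pose t := e / (1 + e).
have t0 : 0 <= t by rewrite divr_ge0; lra.
have t1 : t <= 1 by rewrite ler_pdivrMr; lra.
have := convex_functionP z y cf t0 t1.
have -> : t *: z + (1 - t) *: y = x.
  by apply/colP => i; rewrite !mxE /t; field; rewrite !lt0r_neq0//; lra.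
have te : t <= e by rewrite ler_pdivrMr; nra.
have eM : e * (`|M| + 1) <= f x / 2.
  by rewrite -ler_pdivlMr// -mulrA -invfM ge_min lexx orbT.
have := ler_norm M.
have := normr_ge0 M.
by nra.
Qed.

End ConvexFunctions.

(** * Projection onto a closed convex set *)

(** Transport of [bounded_closed_compact] from rows to columns along the
    transposition. *)
Lemma bounded_closed_compact_col {R : realType} {n : nat} (A : set 'cV[R]_n) :
  bounded_set A -> closed A -> compact A.
Proof.
have cvgT (p q : nat) : continuous (fun M : 'M[R]_(p, q) => M^T).
  move=> M B [P MP PB]; exists (fun i j => P j i) => [i j|N NP].
    by have := MP j i; rewrite mxE.
  by apply: PB => i j; rewrite mxE; exact: NP.
move=> [M [Mr AM]] clA.
have -> : A = trmx @` (trmx @^-1` A).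
  apply/seteqP; split=> [x Ax|x [y Ay <-]//].
  by exists x^T; rewrite /= trmxK.
apply: continuous_compact; first by apply: continuous_subspaceT; exact: cvgT.
apply: bounded_closed_compact; last by apply: closed_comp => // x _; exact: cvgT.
exists M; split => // r Mr' y /= /(AM _ Mr'); apply: le_trans.
by rewrite /Num.Def.normr/= !mx_normrE; apply: bigmax_le => [|[i j] _];
  [exact: bigmax_ge_id|rewrite (le_trans _ (le_bigmax _ _ (j, i)))//= mxE].
Qed.

Section Projection.
Context {R : realType} {n : nat}.
Implicit Types (G : set 'cV[R]_n) (x y z v xi : 'cV[R]_n).

Lemma cvg_le0 {T : Type} (F : set_system T) {FF : ProperFilter F} (h : T -> R)
    (l : R) :
  h t @[t --> F] --> l -> (\forall t \near F, h t <= 0) -> l <= 0.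
Proof.
move=> hl h0; rewrite -(cvg_lim _ hl)//; apply: limr_le => //.
by apply/cvg_ex; exists l.
Qed.

Lemma cvg_dotv {T : Type} (F : set_system T) {FF : Filter F}
    (u w : T -> 'cV[R]_n) (a c : 'cV[R]_n) :
  u t @[t --> F] --> a -> w t @[t --> F] --> c ->
  dotv (u t) (w t) @[t --> F] --> dotv a c.
Proof.
move=> ua wc; apply: cvg_big => [|i _]; first exact: add_continuous.
apply: cvgM.
  exact: (cvg_comp _ _ ua (@coord_continuous R n 1 i ord0 a)).
exact: (cvg_comp _ _ wc (@coord_continuous R n 1 i ord0 c)).
Qed.

Definition convex_closed G : Prop := forall x y (t : R),
  G x -> G y -> 0 <= t -> t <= 1 -> G (t *: x + (1 - t) *: y).

(** A nearest point exists because only the part of G in a Euclidean ball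
    around y matters, and that part is compact. *)
Lemma eproj_nearest G y : G !=set0 -> closed G ->
  G (eproj G y) /\
  forall z, G z -> dotv (y - eproj G y) (y - eproj G y) <= dotv (y - z) (y - z).
Proof.
move=> [z0 Gz0] clG.
pose d z := dotv (y - z) (y - z).
have dcont : continuous d.
  move=> z; have yz : (y - t) @[t --> z] --> y - z.
    apply: (@cvgB _ _ _ (nbhs z) _ (fun=> y)); first exact: cvg_cst.
    exact: cvg_id.
  exact: (cvg_dotv yz yz).
pose A := G `&` [set z | d z <= d z0].
have [q [Gq qz0] qmin] : exists2 q, A q & forall z, A z -> d q <= d z.
  have cA : compact A.
    apply: bounded_closed_compact_col.
      exists (`|y| + (1 + d z0)); split; first exact: num_real.
      move=> r ler z [_ dz]; apply: le_trans (ltW ler).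
      rewrite -[z](subKr y) (le_trans (ler_normB _ _))// lerD2l.
      have d0 := dotvv_ge0 (y - z0); rewrite -/(d z0) in d0.
      apply: sqr_norm_le_dotv; first lra.
      by apply: le_trans dz _; nra.
    apply: closedI => //.
    by apply: closed_comp (@closed_le R _) => z _; apply: dcont.
  have [] := @compact_EVT_min _ R d A.
  - by exists z0; split => /=.
  - exact: cA.
  - exact: continuous_subspaceT.
  by move=> q; rewrite inE => Aq H; exists q => // z Az; apply: H; rewrite inE.
have /(xgetPex 0) : [set q | G q /\
    forall z, G z -> enorm (y - q) <= enorm (y - z)] !=set0.
  exists q; split => // z Gz; rewrite ler_enorm.
  have [zz0|/ltW zz0] := leP (d z) (d z0); first exact: qmin.
  exact: le_trans qz0 zz0.
move=> [GP HP]; split => // z Gz; rewrite -ler_enorm; exact: HP.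
Qed.

(** If the inner product a were positive, moving from the projection q toward z
    by the fraction a / (a + |z - q|^2) would strictly reduce the distance
    to y. *)
Lemma eproj_variational G y z : closed G -> convex_closed G -> G z ->
  dotv (y - eproj G y) (z - eproj G y) <= 0.
Proof.
move=> clG cG Gz; have [Gq qmin] := eproj_nearest y (ex_intro _ z Gz) clG.
move: (eproj G y) Gq qmin => q Gq qmin.
rewrite leNgt; apply/negP; set a := dotv _ _ => a0.
pose s := dotv (z - q) (z - q); have s0 : 0 <= s := dotvv_ge0 _.
pose t := a / (a + s).
have as0 : 0 < a + s by lra.
have t0 : 0 < t by rewrite divr_gt0.
have t1 : t <= 1 by rewrite ler_pdivrMr// mul1r lerDl.
have := qmin _ (cG _ _ t Gz Gq (ltW t0) t1).
have -> : y - (t *: z + (1 - t) *: q) = (y - q) - t *: (z - q).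
  by rewrite scalerBl scale1r scalerBr !opprB !opprD !addrA; apply/colP => i;
    rewrite !mxE; ring.
move: (y - q) (z - q) @a @s @t a0 s0 as0 t0 t1 => u w a s t a0 s0 as0 t0 t1.
rewrite !dotvE (dotvC w u) -/a -/s => H.
have ts : t * s < a.
  by rewrite /t mulrAC ltr_pdivrMr//; nra.
by nra.
Qed.

(** The Moreau decomposition of xi into a tangent part v and a normal part
    xi - v, read off from projections. The quotients w d = (q_d - x) / d, where
    q_d is the projection of x + d xi, satisfy
    <xi - w d, z - x - d w d> <= 0 for z in G; the limit d -> 0 gives the
    normality of xi - v, and the choice z = x gives <v, v> <= <xi, v>, hence the
    bound on the normal part. *)
Lemma tangent_proj_normal G (K : set 'cV[R]_n) x v :
  closed G -> convex_closed G -> G x -> tangent_proj G x K v ->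
  exists2 xi, K xi & (forall z, G z -> dotv (xi - v) (z - x) <= 0) /\
    dotv (xi - v) (xi - v) <= dotv xi xi.
Proof.
move=> clG cG Gx [xi Kxi wv]; exists xi => //.
pose w d := d^-1 *: (eproj G (x + d *: xi) - x).
have wz d z : 0 < d -> G z -> dotv (xi - w d) (z - x - d *: w d) <= 0.
  move=> d0 Gz; have := eproj_variational (x + d *: xi) clG cG Gz.
  have -> : eproj G (x + d *: xi) = x + d *: w d.
    by rewrite /w scalerA mulfV ?lt0r_neq0// scale1r addrCA subrr addr0.
  have -> : x + d *: xi - (x + d *: w d) = d *: (xi - w d).
    by rewrite opprD addrACA subrr add0r scalerBr.
  by rewrite opprD addrA dotvZl pmulr_rle0.
have dv : d *: w d @[d --> 0^'+] --> (0 : 'cV[R]_n).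
  rewrite -[X in _ --> X](scale0r v); apply: cvgZ => //.
  by apply: cvg_at_right_filter; exact: cvg_id.
split=> [z Gz|].
  have : dotv (xi - w d) (z - x - d *: w d) @[d --> 0^'+]
      --> dotv (xi - v) (z - x - 0).
    by apply: cvg_dotv; apply: cvgB => //; exact: cvg_cst.
  rewrite subr0 => /cvg_le0; apply.
  by near=> d; apply: wz.
have : dotv (xi - w d) (- w d) @[d --> 0^'+] --> dotv (xi - v) (- v).
  by apply: cvg_dotv; [apply: cvgB => //; exact: cvg_cst|exact: cvgN].
have : \forall d \near 0^'+, dotv (xi - w d) (- w d) <= 0.
  near=> d; have d0 : 0 < d by [].
  have := wz d x d0 Gx; move: (w d) => u.
  by rewrite subrr sub0r dotvNr dotvZr oppr_le0 pmulr_rge0// dotvNr oppr_le0.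
move=> /[swap]/cvg_le0/[apply].
rewrite !dotvE (dotvC v xi); have := dotvv_ge0 v; lra.
Unshelve. all: by end_near. Qed.

End Projection.

(** * Absolutely continuous functions with nonpositive derivative *)

(** Induction along a segment: the supremum of the points that P reaches is
    itself passed by the step at that point, so it can only be b. The step is
    allowed to start to the left of t, since the supremum need not be known to
    satisfy P. *)
Lemma real_induction {R : realType} (a b : R) (P : R -> Prop) : a <= b ->
  P a ->
  (forall t, a <= t <= b -> exists2 r : R, 0 < r & forall u w,
     a <= u -> u <= t -> t <= w -> w <= b -> w - u < r -> P u -> P w) ->
  P b.
Proof.
move=> ab Pa step; pose S := [set t | a <= t <= b /\ P t].
have Sa : S a by rewrite /S/= lexx ab.
have ubS : ubound S b by move=> t [/andP[]].
have supS : has_sup S by split; [exists a|exists b].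
pose s := sup S.
have sb : s <= b by apply: ge_sup => //; exists a.
have as_ : a <= s by apply: sup_upper_bound.
have [|r r0 Hr] := step s; first by rewrite as_ sb.
have [|u [/andP[au ub] Pu] su] := @sup_adherent _ S (r / 2) _ supS.
  by rewrite divr_gt0.
have us : u <= s by apply: sup_upper_bound => //; rewrite /S/= au ub.
pose w := Num.min b (s + r / 3).
have sw : s <= w by rewrite le_min sb/= lerDl; lra.
have wb : w <= b by rewrite ge_min lexx.
have wr : w <= s + r / 3 by rewrite ge_min lexx orbT.
have Pw : P w by apply: (Hr u) => //; rewrite -/s in su; lra.
have ws : w <= s by apply: sup_upper_bound => //; split=> //; rewrite wb andbT; lra.
suff -> : b = w by [].
rewrite /w; have [//|brs] := leP b (s + r / 3).
have : w = s + r / 3 by rewrite /w; apply: min_r; exact: ltW.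
lra.
Qed.

Section AbsoluteContinuity.
Context {R : realType}.
Implicit Types (V W : normedModType R) (a b : R).

Lemma abs_continuous_on_dominated V W a b (c : R -> V) (d : R -> W) (K : R) :
  0 <= K ->
  (forall u v, a <= u -> u <= v -> v <= b ->
    `|d v - d u| <= K * `|c v - c u|) ->
  abs_continuous_on a b c -> abs_continuous_on a b d.
Proof.
move=> K0 dc ac e e0.
have K1 : 0 < K + 1 by lra.
have [|r r0 Hr] := ac (e / (K + 1)); first by rewrite divr_gt0.
exists r => // N u v uv tI /(Hr _ _ _ uv tI) H.
apply: le_lt_trans (_ : _ <= (K + 1) * \sum_(i < N) `|c (v i) - c (u i)|) _.
  rewrite mulr_sumr; apply: ler_sum => i _; have [h1 h2 h3] := uv i.
  apply: (le_trans (dc _ _ h1 h2 h3)).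
  by rewrite ler_wpM2r//; lra.
by rewrite mulrC -ltr_pdivlMr.
Qed.

Lemma abs_continuous_onD V a b (c d : R -> V) :
  abs_continuous_on a b c -> abs_continuous_on a b d ->
  abs_continuous_on a b (fun t => c t + d t).
Proof.
move=> ac ad e e0.
have [|r r0 Hr] := ac (e / 2); first by rewrite divr_gt0.
have [|s s0 Hs] := ad (e / 2); first by rewrite divr_gt0.
exists (Num.min r s) => [|N u v uv tI]; first by rewrite lt_min r0.
rewrite lt_min => /andP[/(Hr _ _ _ uv tI) H1 /(Hs _ _ _ uv tI) H2].
apply: le_lt_trans (_ : _ <= \sum_(i < N) `|c (v i) - c (u i)| +
    \sum_(i < N) `|d (v i) - d (u i)|) _; last lra.
rewrite -big_split; apply: ler_sum => i _ /=.
by rewrite opprD addrACA ler_normD.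
Qed.

(** The modulus of absolute continuity for the tolerance 1 bounds the increments
    of c over short intervals, and finitely many of these cover the segment. *)
Lemma abs_continuous_on_bounded V a b (c : R -> V) : a <= b ->
  abs_continuous_on a b c ->
  exists2 M, 0 <= M & forall t, a <= t <= b -> `|c t| <= M.
Proof.
move=> ab ac; have [r r0 Hr] := ac 1 ltr01.
have H u v : a <= u -> u <= v -> v <= b -> v - u < r -> `|c v - c u| < 1.
  move=> au uv vb vur; have := Hr 1%N (fun=> u) (fun=> v).
  rewrite !big_ord1; apply => // i j _ _ _.
  by rewrite (ord1 i) (ord1 j).
apply: (real_induction (P := fun s => exists2 M, 0 <= M &
  forall t, a <= t <= s -> `|c t| <= M) ab) => [|t atb].
  by exists `|c a| => // t; rewrite -eq_le => /eqP <-.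
exists r => // u w au ut tw wb wur [M M0 HM]; exists (M + 1) => [|s /andP[as_ sw]].
  lra.
have [su|us] := leP s u; first by rewrite (le_trans (HM s _)) ?as_//; lra.
have := H u s au (ltW us); rewrite (le_trans sw wb) => /(_ isT).
have cu := HM u; rewrite au lexx in cu; have {}cu := cu isT.
move=> /(_ _)/wrap[|cs]; first lra.
have := ler_normD (c s - c u) (c u); rewrite subrK; lra.
Qed.

Lemma abs_continuous_on_dotvv {n : nat} a b (c : R -> 'cV[R]_n) : a <= b ->
  abs_continuous_on a b c -> abs_continuous_on a b (fun t => dotv (c t) (c t)).
Proof.
move=> ab ac; have [M M0 HM] := abs_continuous_on_bounded ab ac.
apply: abs_continuous_on_dominated (n%:R * (2 * M)) _ _ ac.
  by rewrite mulr_ge0//; lra.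
move=> u v au uv vb.
have -> : dotv (c v) (c v) - dotv (c u) (c u) = dotv (c v - c u) (c v + c u).
  by rewrite !dotvE (dotvC (c v) (c u)); ring.
have vM : `|c v| <= M by rewrite HM// (le_trans au uv).
have uM : `|c u| <= M by rewrite HM// au (le_trans uv vb).
apply: (le_trans (ler_norm_sum _ _ _)).
apply: (@le_trans _ _ (\sum_(i < n) (2 * M) * `|c v - c u|)).
  apply: ler_sum => i _; rewrite normrM mulrC ler_pM//.
    apply: (le_trans (coord_le_norm _ _)).
    by apply: (le_trans (ler_normD _ _)); lra.
  exact: coord_le_norm.
by rewrite sumr_const card_ord -[_ *+ n]mulr_natl !mulrA.
Qed.

Lemma sum_itv_lt_measure (N : nat) (u v : nat -> R) (U : set R) (d : R) :
  open U -> (lebesgue_measure U < d%:E)%E ->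
  (forall i, (i < N)%N -> u i <= v i /\ `]u i, v i[%classic `<=` U) ->
  trivIset `I_N (fun i => `]u i, v i[%classic) ->
  \sum_(i < N) (v i - u i) < d.
Proof.
move=> oU Ud uvU tI; rewrite -lte_fin; apply: le_lt_trans Ud.
pose F i : set R := `]u i, v i[%classic.
have mF i : measurable (F i) by exact: measurable_itv.
have <- : lebesgue_measure (\big[setU/set0]_(i < N) F i) =
    (\sum_(i < N) (v i - u i))%:E.
  rewrite measure_semi_additive_ord_I => [|k _||]; last 3 first.
  - exact: mF.
  - exact: tI.
  - by apply: bigsetU_measurable => i _; exact: mF.
  rewrite -sumEFin; apply: eq_bigr => i _.
  have [uv _] := uvU i (ltn_ord i).
  apply: etrans (lebesgue_measure_itv `]u i, v i[) _; rewrite /= lte_fin.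
  by case: ltgtP uv => // -> _; rewrite subrr.
apply: le_measure; rewrite ?inE.
- by apply: bigsetU_measurable => i _; exact: mF.
- exact: open_measurable.
by rewrite -bigcup_mkord => t [i /= iN Ft]; have [_] := uvU i iN; exact.
Qed.

(** Fix e. The exceptional null set is covered by an open set U of measure below
    the modulus d of absolute continuity for e. From a to b one advances by
    intervals around a point t that lie in U if t is in U, and on which phi
    grows at rate at most e otherwise ([real_induction]). The growth along the second
    kind totals at most e (b - a); the intervals of the first kind are disjoint
    and of total length below d, so absolute continuity bounds the growth along
    them by e. The hypothesis on two-sided increments is what
    [is_derive_le0_upper] extracts from a nonpositive derivative. *)
Lemma abs_continuous_nonincreasing a b (phi : R -> R) : a <= b ->
  abs_continuous_on a b phi ->
  {ae @lebesgue_measure R, forall t, a <= t <= b ->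
    forall e, 0 < e -> exists2 r : R, 0 < r & forall u w,
      u <= t -> t <= w -> w - u < r -> phi w - phi u <= e * (w - u)} ->
  phi b <= phi a.
Proof.
move=> ab ac [D [mD D0 HD]].
suff H e : 0 < e -> phi b - phi a <= e * (b - a) + e.
  rewrite -subr_le0; apply/ler_addgt0Pl => e e0; rewrite addr0.
  have ba : 0 < b - a + 1 by lra.
  have := H (e / (b - a + 1)); rewrite divr_gt0// => /(_ isT) /le_trans; apply.
  by rewrite -{2}[e / _]mulr1 -mulrDr mulfVK// gt_eqF.
move=> e0; have [d d0 Hd] := ac e e0.
have [|U [oU DU Ud]] := @lebesgue_regularity_outer R D d mD _ d0.
  by rewrite (_ : _ D = 0%E) ?ltry//; exact: D0.
have {}Ud : (lebesgue_measure U < d%:E)%E.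
  have -> : U = (U `\` D) `|` D by rewrite setUC setDUK.
  apply: le_lt_trans Ud; rewrite -[leRHS]adde0.
  rewrite -[X in (_ + X)%E](D0 : lebesgue_measure D = 0%E).
  apply: measureU2 => //; apply: measurableD => //; exact: open_measurable.
(* P t records the advance up to t: the finitely many intervals in U are listed
   from left to right, so that disjointness survives appending one more. *)
pose P t := exists N (u v : nat -> R),
  [/\ forall i, (i < N)%N -> [/\ a <= u i, u i <= v i, v i <= t &
        `]u i, v i[%classic `<=` U],
      forall i j, (i < j < N)%N -> v i <= u j &
      phi t - phi a <= e * (t - a) + \sum_(i < N) `|phi (v i) - phi (u i)|].
have : P b.
  apply: real_induction ab _ _.
    exists 0%N, (fun=> 0), (fun=> 0); split=> //.
    by rewrite big_ord0 !subrr mulr0 addr0.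
  move=> t /andP[at_ tb]; have [Ut|nUt] := pselect (U t).
    have [r /= r0 rU] : nbhs_ball t U by apply/nbhs_ballP; exact: open_nbhs_nbhs.
    exists r => // p q ap pt tq qb qpr [N [u [v [uvp uv_sorted phip]]]].
    exists N.+1, (fun i => if i == N then p else u i),
      (fun i => if i == N then q else v i); split.
    - move=> i; rewrite ltnS leq_eqVlt; case: eqVneq => [_ _|_ /= iN].
        split => //; first exact: le_trans tq.
        move=> s /=; rewrite in_itv/= => /andP[ps sq]; apply: rU.
        by rewrite /ball/= ltr_norml; lra.
      by have [h1 h2 h3 h4] := uvp i iN; split => //; lra.
    - move=> i j /andP[ij]; rewrite ltnS leq_eqVlt.
      case: (eqVneq j N) ij => [->|_] /= ij jN.
        by rewrite ltn_eqF//; have [_ _ + _] := uvp i ij; exact.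
      rewrite ltn_eqF ?(ltn_trans ij)//.
      by apply: uv_sorted; rewrite ij.
    - rewrite big_ord_recr/= eqxx.
      have -> : \sum_(i < N) `|phi (if val i == N then q else v i) -
          phi (if val i == N then p else u i)| =
          \sum_(i < N) `|phi (v i) - phi (u i)|.
        by apply: eq_bigr => i _; rewrite /= (ltn_eqF (ltn_ord i)).
      have := ler_norm (phi q - phi p).
      have : e * (p - a) <= e * (q - a) by rewrite ler_pM2l//; lra.
      by move: phip; lra.
  have nDt : ~ D t by move=> /DU.
  have /(_ e e0)[r r0 Hr] : forall e, 0 < e -> exists2 r : R, 0 < r &
      forall u w, u <= t -> t <= w -> w - u < r ->
        phi w - phi u <= e * (w - u).
    by apply: (contrapT (fun h => nDt (HD t h))); rewrite at_ tb.
  exists r => // p q ap pt tq qb qpr [N [u [v [uvp uv_sorted phip]]]].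
  exists N, u, v; split => //.
    by move=> i /uvp[h1 h2 h3 h4]; split => //; lra.
  have := Hr p q pt tq qpr.
  have -> : e * (q - a) = e * (q - p) + e * (p - a) by ring.
  lra.
move=> [N [u [v [uvb uv_sorted phib]]]].
apply: (le_trans phib); rewrite lerD2l ltW//.
have tI : trivIset `I_N (fun i => `]u i, v i[%classic).
  apply/trivIsetP => i j /= iN jN ij; apply/seteqP; split => // s [] /=.
  rewrite !in_itv/= => /andP[s1 s2] /andP[s3 s4].
  wlog {ij} : i j iN jN s1 s2 s3 s4 / (i < j)%N.
    move=> H; have [ij'|ji|ij'] := ltngtP i j; last by rewrite ij' eqxx in ij.
      exact: (H i j).
    exact: (H j i).
  move=> ij; have := uv_sorted i j; rewrite ij jN => /(_ isT); lra.
apply: (Hd N (fun i => u i) (fun i => v i)) => [i||].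
- by have [h1 h2 h3 h4] := uvb i (ltn_ord i).
- move=> i j _ _ /= H; apply/val_inj; apply: tI => //=; exact: ltn_ord.
apply: sum_itv_lt_measure oU Ud _ tI => i /uvb[h1 h2 h3 h4]; by split.
Qed.

(** The increment over an interval around t splits at t into two increments,
    each controlled by the derivative at t. *)
Lemma is_derive_le0_upper (phi : R -> R) (t L e : R) :
  is_derive t 1 phi L -> L <= 0 -> 0 < e -> exists2 r : R, 0 < r & forall u w,
    u <= t -> t <= w -> w - u < r -> phi w - phi u <= e * (w - u).
Proof.
move=> [dphi <-] L0 e0.
have /cvgrPdist_le/(_ e e0) :
    h^-1 *: (phi (h *: 1 + t) - phi t) @[h --> 0^'] --> 'D_1 phi t.
  exact: dphi.
move=> [r /= r0 Hr]; exists r => // u w ut tw wur.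
have Hq s : s != t -> `|s - t| < r -> (phi s - phi t) / (s - t) <= e.
  move=> st str; have st0 : s - t != 0 by rewrite subr_eq0.
  have := Hr (s - t); rewrite /= sub0r normrN => /(_ str st0).
  rewrite [_ *: 1]mulr1 subrK ler_norml => /andP[+ _].
  rewrite [_^-1 *: _]mulrC; lra.
have Hw : phi w - phi t <= e * (w - t).
  have [->|wt] := eqVneq w t; first by rewrite !subrr mulr0.
  have wt0 : 0 < w - t by rewrite subr_gt0 lt_neqAle eq_sym wt.
  by rewrite -ler_pdivrMr// Hq// gtr0_norm//; lra.
have Hu : phi t - phi u <= e * (t - u).
  have [->|tu] := eqVneq u t; first by rewrite !subrr mulr0.
  have tu0 : 0 < t - u by rewrite subr_gt0 lt_neqAle tu.
  rewrite -ler_pdivrMr//; have := Hq u tu; rewrite distrC gtr0_norm//.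
  by rewrite -(opprB t u) -(opprB (phi t)) invrN mulrNN; apply; lra.
have -> : e * (w - u) = e * (w - t) + e * (t - u) by ring.
lra.
Qed.

Lemma is_derive_dotvv {n : nat} (c : R -> 'cV[R]_n) (k v : 'cV[R]_n) (t : R) :
  is_derive t 1 c v ->
  is_derive t 1 (fun s => dotv (c s - k) (c s - k)) (2 * dotv (c t - k) v).
Proof.
move=> cv.
have ci (i : 'I_n) : is_derive t 1 (fun s => c s i ord0 : R) (v i ord0).
  have [dc <-] := cv; rewrite derive_mx// mxE; apply: DeriveDef => //.
  by move/derivable_mxP: dc.
have -> : (fun s => dotv (c s - k) (c s - k)) =
    \sum_(i < n) (fun s => (c s i ord0 - k i ord0) ^+ 2).
  apply/funext => s; rewrite fct_sumE; apply: eq_bigr => i _.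
  by rewrite !mxE expr2.
have -> : 2 * dotv (c t - k) v =
    \sum_(i < n) 2 * (c t i ord0 - k i ord0) * v i ord0.
  by rewrite mulr_sumr; apply: eq_bigr => i _; rewrite !mxE mulrA.
apply: is_derive_sum => i.
have di : is_derive t 1 (fun s => c s i ord0 - k i ord0) (v i ord0).
  by apply: is_derive_eq (subr0 _).
apply: is_derive_eq.
set a := c t i ord0 - k i ord0; set y := v i ord0.
have -> : 2 * a * y = a * y + a * y by ring.
by [].
Qed.

End AbsoluteContinuity.

(** * Slater points: exact penalty and Lagrange multipliers *)

Section Slater.
Context {R : realType} {n m : nat} (g : 'cV[R]_n -> 'cV[R]_m)
  (g_convex : forall k : 'I_m, convex_function setT (fun x => g x k ord0)).

Definition violation (x : 'cV[R]_n) : R := \sum_(k < m) Num.max 0 (g x k ord0).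

Lemma violation_ge0 x : 0 <= violation x.
Proof. by apply: sumr_ge0 => k _; rewrite le_max lexx. Qed.

Lemma violation_eq0 x : ineq_set g x -> violation x = 0.
Proof. by move=> gx; apply: big1 => k _; apply: max_l. Qed.

Lemma ineq_set_convex : convex_closed (ineq_set g).
Proof.
move=> x y t gx gy t0 t1 k.
apply: (le_trans (convex_functionP x y (g_convex k) t0 t1)).
by have := gx k; have := gy k; nra.
Qed.

Lemma ineq_set_closed : closed (ineq_set g).
Proof.
have -> : ineq_set g = \bigcap_(k in setT) [set x | g x k ord0 <= 0].
  by apply/seteqP; split=> [x gx k _|x gx k]; [exact: gx|exact: gx].
apply: closed_bigI => k _; exact: convex_sublevel_closed.
Qed.

Lemma slater_gap z : (forall k, g z k ord0 < 0) ->
  exists2 s, 0 < s & forall k, g z k ord0 <= - s.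
Proof.
move=> gz; exists (\big[Num.min/1]_k (- g z k ord0)) => [|k].
  by apply/bigmin_gtP; split=> // k _; rewrite oppr_gt0.
by rewrite lerNr; apply: bigmin_le.
Qed.

(** The weight t balances t * violation y = (1 - t) * s: along the way to z each
    constraint gains from z at least what it loses at y. *)
Lemma slater_pull z s y : 0 < s -> (forall k, g z k ord0 <= - s) ->
  let t := s / (s + violation y) in ineq_set g (t *: y + (1 - t) *: z).
Proof.
move=> s0 gz t k; have P0 := violation_ge0 y.
have sP : 0 < s + violation y by lra.
have t0 : 0 <= t by rewrite divr_ge0; lra.
have t1 : t <= 1 by rewrite ler_pdivrMr; lra.
apply: (le_trans (convex_functionP y z (g_convex k) t0 t1)).
have gP : g y k ord0 <= violation y.
  rewrite /violation (bigD1 k)//= (le_trans (_ : _ <= Num.max 0 (g y k ord0)))//.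
    by rewrite le_max lexx orbT.
  by rewrite lerDl; apply: sumr_ge0 => j _; rewrite le_max lexx.
have tP : t * violation y = (1 - t) * s.
  by rewrite /t; field; rewrite gt_eqF.
have : t * g y k ord0 <= t * violation y by rewrite ler_wpM2l.
have : (1 - t) * g z k ord0 <= (1 - t) * - s by rewrite ler_wpM2l//; lra.
lra.
Qed.

(** The point of [slater_pull] lies in G, so the normal eta gives
    t <eta, y - x> <= (1 - t) <eta, x - z>, and (1 - t) / t is
    violation y / s. *)
Lemma slater_exact_penalty z s x eta (K : R) :
  0 < s -> (forall k, g z k ord0 <= - s) ->
  (forall w, ineq_set g w -> dotv eta (w - x) <= 0) ->
  dotv eta (x - z) <= K * s -> forall y, dotv eta (y - x) <= K * violation y.
Proof.
move=> s0 gz normal etaK y.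
have /= := normal _ (slater_pull y s0 gz).
have P0 := violation_ge0 y; set t := _ / _.
have sP : 0 < s + violation y by lra.
have t0 : 0 < t by rewrite divr_gt0.
have -> : t *: y + (1 - t) *: z - x = t *: (y - x) + (1 - t) *: (z - x).
  by apply/colP => i; rewrite !mxE; ring.
rewrite !dotvE => H.
move: etaK; rewrite !dotvE => etaK.
have tP : t * violation y = (1 - t) * s.
  by rewrite /t; field; rewrite gt_eqF.
have t1 : 0 <= 1 - t by rewrite subr_ge0 ler_pdivrMr//; lra.
rewrite -(ler_pM2l t0) mulrCA tP.
by nra.
Qed.

End Slater.

Section Multiplier.
Context {R : realType} {n : nat}.

(** For one affine constraint h = 0, the multiplier l must lie above all slopes
    (c - F x) / h x with h x > 0 and below all slopes (F y - c) / (- h y) with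
    h y < 0. Any slope of the first kind is at most any slope of the second,
    because the segment from x to y meets h = 0 where F >= c; the supremum of
    the first kind is therefore a valid choice. *)
Lemma multiplier_step (X : set 'cV[R]_n) (F h : 'cV[R]_n -> R) (c : R) :
  convex_closed X ->
  (forall x y t, X x -> X y -> 0 <= t -> t <= 1 ->
    F (t *: x + (1 - t) *: y) <= t * F x + (1 - t) * F y) ->
  (forall x y t, h (t *: x + (1 - t) *: y) = t * h x + (1 - t) * h y) ->
  (exists2 x, X x & 0 < h x) -> (exists2 x, X x & h x < 0) ->
  (forall x, X x -> h x = 0 -> c <= F x) ->
  exists l : R, forall x, X x -> c <= F x + l * h x.
Proof.
move=> cX cF ah [x1 Xx1 hx1] [x2 Xx2 hx2] cFh.
pose S := [set (c - F x) / h x | x in [set x | X x /\ 0 < h x]].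
have cross x y : X x -> 0 < h x -> X y -> h y < 0 ->
    (c - F x) / h x <= (F y - c) / - h y.
  move=> Xx hx Xy hy; have hxy : 0 < h x - h y by lra.
  pose t := - h y / (h x - h y).
  have t0 : 0 <= t by rewrite divr_ge0; lra.
  have t1 : t <= 1 by rewrite ler_pdivrMr; lra.
  have e1 : 1 - t = h x / (h x - h y) by rewrite /t; field; rewrite gt_eqF.
  have := cFh _ (cX x y t Xx Xy t0 t1).
  have -> : h (t *: x + (1 - t) *: y) = 0.
    by rewrite ah e1 /t; field; rewrite gt_eqF.
  move=> /(_ erefl) /le_trans /(_ (cF x y t Xx Xy t0 t1)).
  rewrite e1 /t => H; rewrite ler_pdivrMr// mulrAC ler_pdivlMr ?oppr_gt0//.
  suff : 0 <= (h x - h y) *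
      (- h y / (h x - h y) * F x + h x / (h x - h y) * F y - c).
    rewrite (_ : _ * _ = (F y - c) * h x - (c - F x) * - h y) ?subr_ge0//.
    by field; rewrite gt_eqF.
  by apply: mulr_ge0; [exact: ltW|rewrite subr_ge0].
have supS : has_sup S.
  split; first by exists ((c - F x1) / h x1), x1.
  by exists ((F x2 - c) / - h x2) => _ [x [Xx hx] <-]; exact: cross.
exists (sup S) => x Xx.
have [hx|hx|hx] := ltgtP (h x) 0.
- have : sup S <= (F x - c) / - h x.
    by apply: ge_sup; [exact: supS.1|move=> _ [y [Xy hy] <-]; exact: cross].
  by rewrite ler_pdivlMr ?oppr_gt0//; lra.
- have : (c - F x) / h x <= sup S by apply: sup_upper_bound => //; exists x.
  by rewrite ler_pdivrMr//; lra.
- by rewrite hx mulr0 addr0; exact: cFh.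
Qed.

Lemma eq_constr_affine {p : nat} (A : 'M[R]_(p, n)) b x y t :
  eq_constr A b (t *: x + (1 - t) *: y) =
  t *: eq_constr A b x + (1 - t) *: eq_constr A b y.
Proof.
rewrite /eq_constr mulmxDr -!scalemxAr.
by apply/colP => i; rewrite !mxE; ring.
Qed.

(** [multiplier_step] removes the equality constraints one after the other:
    after k steps the first k of them are paid for by multipliers and the others
    are still imposed. The full rank of A lets the residual be moved along each
    single coordinate, and [slater_pull] does so inside G, which provides the
    points with h > 0 and h < 0 that the step asks for. *)
Lemma lagrange_multiplier {m p : nat} (F : 'cV[R]_n -> R)
    (g : 'cV[R]_n -> 'cV[R]_m) (A : 'M[R]_(p, n)) b (c : R) :
  convex_function setT F ->
  (forall k : 'I_m, convex_function setT (fun x => g x k ord0)) ->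
  \rank A = p ->
  (exists x, eq_constr A b x = 0 /\ forall k : 'I_m, g x k ord0 < 0) ->
  (forall x, feasible_set g (eq_constr A b) x -> c <= F x) ->
  exists l, forall x, ineq_set g x -> c <= F x + dotv l (eq_constr A b x).
Proof.
move=> cF cg rA [z [hz gz]] cFx; set h := eq_constr A b in hz cFx *.
have [s s0 gzs] := slater_gap gz.
have /row_freeP[B AB] : row_free A by rewrite /row_free rA.
(* Points of G whose residual is a prescribed multiple of the k-th unit vector,
   up to a positive factor; a will be 1 and then -1. *)
have unit_dir (k : 'I_p) (a : R) : exists2 t, 0 < t &
    exists2 w, ineq_set g w & h w = (t * a) *: delta_mx k ord0.
  pose y := z + B *m (a *: delta_mx k ord0).
  have hy : h y = a *: delta_mx k ord0.
    by rewrite /h /eq_constr mulmxDr mulmxA AB mul1mx addrAC [X in X + _]hz add0r.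
  exists (s / (s + violation g y)).
    by rewrite divr_gt0// ltr_wpDr// violation_ge0.
  exists (s / (s + violation g y) *: y + (1 - s / (s + violation g y)) *: z).
    exact: slater_pull.
  by rewrite /h eq_constr_affine -/h hy [h z]hz scaler0 addr0 scalerA.
have haff x y t : h (t *: x + (1 - t) *: y) = t *: h x + (1 - t) *: h y.
  exact: eq_constr_affine.
clearbody h.
suff H k : (k <= p)%N -> exists l, forall x, ineq_set g x ->
    (forall j : 'I_p, (k <= j)%N -> h x j ord0 = 0) -> c <= F x + dotv l (h x).
  have [l Hl] := H p (leqnn p); exists l => x gx; apply: Hl => // j.
  by rewrite leqNgt ltn_ord.
elim: k => [_|k IH kp].
  exists 0 => x gx hx; rewrite dotvC dotv0r addr0; apply: cFx; split => //.
  by apply/colP => j; rewrite hx// mxE.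
have [l Hl] := IH (ltnW kp).
pose k' := Ordinal kp.
pose X := [set x | ineq_set g x /\
  forall j : 'I_p, (k < j)%N -> h x j ord0 = 0].
have Xdelta a w : ineq_set g w -> h w = a *: delta_mx k' ord0 -> X w.
  move=> gw hw; split => // j kj; rewrite hw !mxE.
  by rewrite -val_eqE/= (gtn_eqF kj) mulr0.
have [||||||r Hr] := @multiplier_step X (fun x => F x + dotv l (h x))
    (fun x => h x k' ord0) c.
- move=> x y t [gx hx] [gy hy] t0 t1; split; first exact: ineq_set_convex.
  by move=> j kj; rewrite haff !mxE hx// hy// !mulr0 addr0.
- move=> x y t _ _ t0 t1; rewrite haff !dotvE.
  have := convex_functionP x y cF t0 t1; lra.
- by move=> x y t; rewrite haff !mxE.
- have [t t0 [w gw hw]] := unit_dir k' 1; exists w; first exact: Xdelta hw.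
  by rewrite hw !mxE !eqxx !mulr1.
- have [t t0 [w gw hw]] := unit_dir k' (-1); exists w; first exact: Xdelta hw.
  by rewrite hw !mxE !eqxx mulr1 mulrN1 oppr_lt0.
- move=> x [gx hx] hxk; apply: Hl => // j; rewrite leq_eqVlt => /orP[/eqP kj|].
    by rewrite -hxk; congr (h x _ _); apply: val_inj.
  exact: hx.
exists (l + r *: delta_mx k' ord0) => x gx hx.
rewrite dotvDl dotvZl dotv_delta addrA; apply: Hr; split => //.
Qed.

End Multiplier.

(** * Saddle-point dynamics *)

Section SaddlePointDynamics.
Context {R : realType} {n m p : nat}.
Context (f : 'cV[R]_n -> R) (g : 'cV[R]_n -> 'cV[R]_m)
  (A : 'M[R]_(p, n)) (b : 'cV[R]_p) (mu : R)
  (f_convex : convex_function setT f)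
  (g_convex : forall k : 'I_m, convex_function setT (fun x => g x k ord0))
  (mu_gt0 : 0 < mu).

Local Notation h := (eq_constr A b).

Lemma eq_constrB x y : A *m (x - y) = h x - h y.
Proof. by rewrite /eq_constr mulmxBr opprB addrA subrK. Qed.

Lemma dotv_F_field x lam xi w y : xi = - (mu^-1 *: (A^T *m (A *m x - b))) -
    A^T *m lam - w ->
  dotv xi (y - x) = - (mu^-1 * dotv (h x) (h y - h x)) - dotv lam (h y - h x)
    - dotv w (y - x).
Proof.
by move=> ->; rewrite -eq_constrB !(dotvDl, dotvNl, dotvZl, dotv_mulmx).
Qed.

(** Sum of four subgradient inequalities at x: for f, for the quadratic and the
    linear term in h, and for kappa * violation, which vanishes at x. *)
Lemma lagrangian_subgradient (kappa : R) x lam xi v :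
  ineq_set g x -> F_field f A b mu x lam xi ->
  (forall y, dotv (xi - v) (y - x) <= kappa * violation g y) ->
  subdifferential (fun z => lagrangian f g h mu kappa z lam) x (- v).
Proof.
move=> gx [w wf Exi] penalty y.
have := penalty y; rewrite dotvDl (dotv_F_field y (esym Exi)).
have := wf y; rewrite /lagrangian !enorm_sqr -!/(violation g _).
rewrite (violation_eq0 gx) dotvNl invfM.
have i0 : 0 <= mu^-1 by rewrite invr_ge0 ltW.
move: (h x) (h y) mu^-1 i0 => a c i i0 Hf.
have : 0 <= i * dotv (c - a) (c - a) by rewrite mulr_ge0// dotvv_ge0.
move: Hf; rewrite !dotvE (dotvC c a); lra.
Qed.

Lemma F_field_bounded (M : R) : exists2 B : R, 0 <= B &
  forall x lam xi, `|x| <= M -> `|lam| <= M -> F_field f A b mu x lam xi ->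
    `|xi| <= B.
Proof.
have [K K0 HK] := mulmx_norm_le A.
have [KT KT0 HKT] := mulmx_norm_le A^T.
have [Ks Ks0 HKs] := subgradient_bounded M f_convex.
have mu0 : 0 <= mu^-1 by rewrite invr_ge0 ltW.
exists (mu^-1 * (KT * (K * `|M| + `|b|)) + KT * `|M| + Ks).
  by rewrite !(addr_ge0, mulr_ge0).
move=> x lam _ xM lamM [w wf <-].
have M0 := ler_norm M.
apply: (le_trans (ler_normB _ _)); apply: lerD; last exact: HKs wf.
apply: (le_trans (ler_normB _ _)); apply: lerD; last first.
  by apply: (le_trans (HKT _)); rewrite ler_wpM2l// (le_trans lamM).
rewrite normrN normrZ ger0_norm// ler_wpM2l//.
apply: (le_trans (HKT _)); rewrite ler_wpM2l//.
apply: (le_trans (ler_normB _ _)); apply: lerD => //.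
by apply: (le_trans (HK _)); rewrite ler_wpM2l// (le_trans xM).
Qed.

(** The left side is half the derivative of |x - xs|^2 + |lam - ls|^2 along the
    dynamics. Dropping the normal part of the field only increases it; what
    remains is at most f xs - f x - <ls, h x> - |h x|^2 / mu by convexity of f,
    the terms in lam cancelling because h xs = 0, and this is nonpositive by the
    saddle inequality. *)
Lemma spld_dissipation xs ls x lam v :
  ineq_set g xs -> h xs = 0 ->
  (forall y, ineq_set g y -> f xs <= f y + dotv ls (h y)) ->
  ineq_set g x -> tangent_proj (ineq_set g) x (F_field f A b mu x lam) v ->
  dotv (x - xs) v + dotv (lam - ls) (h x) <= 0.
Proof.
move=> gxs hxs saddle gx.
move=> /(tangent_proj_normal (ineq_set_closed g_convex)
  (ineq_set_convex g_convex) gx)[xi [w wf Exi] [normal _]].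
have := normal _ gxs; have := saddle _ gx; have := wf xs.
rewrite dotvDl (dotv_F_field xs (esym Exi)) hxs sub0r !dotvNr !dotvNl.
have -> : dotv (x - xs) v = - dotv v (xs - x).
  by rewrite dotvC -opprB dotvNr.
have : 0 <= mu^-1 * dotv (h x) (h x).
  by rewrite mulr_ge0 ?dotvv_ge0// invr_ge0 ltW.
rewrite dotvDl dotvNl; lra.
Qed.

(** The squared distance to the saddle point (xs, ls) is absolutely continuous
    and has nonpositive derivative almost everywhere, hence never exceeds its
    initial value. *)
Lemma spld_bounded xs ls x lam :
  ineq_set g xs -> h xs = 0 ->
  (forall y, ineq_set g y -> f xs <= f y + dotv ls (h y)) ->
  spld_solution f g A b mu x lam ->
  exists M : R, forall t, 0 <= t -> `|x t| <= M /\ `|lam t| <= M.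
Proof.
move=> gxs hxs saddle [Gx [xac lamac xlam]].
pose V t := dotv (x t - xs) (x t - xs) + dotv (lam t - ls) (lam t - ls).
have V_le t : 0 <= t -> V t <= V 0.
  move=> t0; apply: abs_continuous_nonincreasing => //.
    apply: abs_continuous_onD; apply: abs_continuous_on_dotvv => //.
      apply: abs_continuous_on_dominated ler01 _ (xac t t0) => u v _ _ _.
      by rewrite mul1r opprB addrA subrK.
    apply: abs_continuous_on_dominated ler01 _ (lamac t t0) => u v _ _ _.
    by rewrite mul1r opprB addrA subrK.
  have n0 : {ae @lebesgue_measure R, forall s : R, s != 0}.
    exists [set 0]; split; [exact: measurable_set1|exact: lebesgue_measure_set1|].
    by move=> s /= /negP; rewrite negbK => /eqP.
  have FF := ae_filter_ringOfSetsType (@lebesgue_measure R).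
  apply: (@filterS2 _ _ FF) n0 xlam => s s0 xs_s /andP[s_ge0 _] e e0.
  have s_gt0 : 0 < s by rewrite lt_neqAle eq_sym s0.
  have [[v xv Fv] lamv] := xs_s s_gt0.
  have dV : is_derive s 1 V
      (2 * dotv (x s - xs) v + 2 * dotv (lam s - ls) (h (x s))).
    by apply: is_deriveD; exact: is_derive_dotvv.
  apply: is_derive_le0_upper dV _ e0.
  have := spld_dissipation gxs hxs saddle (Gx _ s_ge0) Fv; lra.
(* Since V 0 <= (1 + V 0)^2, this M bounds the Euclidean distance. *)
pose M := 1 + V 0.
have V0 : 0 <= V 0 by rewrite addr_ge0// dotvv_ge0.
have VM t : 0 <= t -> V t <= M ^+ 2.
  move=> t0; apply: (le_trans (V_le t t0)); rewrite /M; nra.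
exists (M + `|xs| + `|ls|) => t t0; have := VM t t0; rewrite /V => VtM.
have M0 : 0 <= M by rewrite /M; lra.
have dx := dotvv_ge0 (x t - xs); have dl := dotvv_ge0 (lam t - ls).
have xM : `|x t - xs| <= M by apply: sqr_norm_le_dotv => //; lra.
have lM : `|lam t - ls| <= M by apply: sqr_norm_le_dotv => //; lra.
split.
  have := ler_normD (x t - xs) xs; rewrite subrK; have := normr_ge0 ls; lra.
have := ler_normD (lam t - ls) ls; rewrite subrK; have := normr_ge0 xs; lra.
Qed.

End SaddlePointDynamics.

Unset Implicit Arguments.
Set Strict Implicit.

Theorem proposition4p2 (R : realType) (n m p : nat)
  (f : 'cV[R]_n -> R) (g : 'cV[R]_n -> 'cV[R]_m)
  (A : 'M[R]_(p, n)) (b : 'cV[R]_p) (mu : R)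
  (p_le_n : (p <= n)%N)
  (f_convex : convex_function setT f)
  (g_convex : forall k : 'I_m, convex_function setT (fun x => g x k ord0))
  (S_nonempty :
     solution_set f (feasible_set g (eq_constr A b)) !=set0)
  (S_bounded :
     bounded_set (solution_set f (feasible_set g (eq_constr A b))))
  (A1 : \rank A = p)
  (A2 : exists x : 'cV[R]_n,
     eq_constr A b x = 0 /\ forall k : 'I_m, g x k ord0 < 0)
  (mu_gt0 : 0 < mu)
  (x0 : 'cV[R]_n) (lam0 : 'cV[R]_p) (x0_in_G : ineq_set g x0)
  (x : R -> 'cV[R]_n) (lam : R -> 'cV[R]_p)
  (x_lam_spld : spld_solution f g A b mu x lam)
  (x_init : x 0 = x0) (lam_init : lam 0 = lam0) :
  exists2 kappa : R, 0 < kappa & spd_solution f g A b mu kappa x lam.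
Proof.
have [xs [[hxs gxs] fxs]] := S_nonempty.
have xs_min y : feasible_set g (eq_constr A b) y -> f xs <= f y.
  by move=> Cy; rewrite -lee_fin fxs; apply: ereal_inf_lbound; exists y.
have [ls saddle] := lagrange_multiplier f_convex g_convex A1 A2 xs_min.
have [M HM] := spld_bounded g_convex mu_gt0 gxs hxs saddle x_lam_spld.
have [B B0 HB] := F_field_bounded A b f_convex mu_gt0 M.
have [z [_ gz]] := A2; have [s s0 gzs] := slater_gap gz.
(* Twice <eta, x t - z> is at most |eta|^2 + |x t - z|^2, and Q bounds this sum
   for all t. *)
pose Q := n%:R * B ^+ 2 + n%:R * (M + `|z|) ^+ 2.
have Q0 : 0 <= Q by rewrite addr_ge0// mulr_ge0// exprn_even_ge0.
exists (Q / s + 1); first by rewrite ltr_wpDl// divr_ge0// ltW.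
have [Gx [xac lamac xlam]] := x_lam_spld; split => //.
have FF := ae_filter_ringOfSetsType (@lebesgue_measure R).
apply: (@filterS _ _ FF) xlam => t xt t0; have [[v xv Fv] lamv] := xt t0; split => //.
exists v => //; have gx := Gx _ (ltW t0); have [xM lamM] := HM _ (ltW t0).
have [xi Fxi [normal vxi]] := tangent_proj_normal (ineq_set_closed g_convex)
  (ineq_set_convex g_convex) gx Fv.
exists (- v); last by rewrite opprK.
apply: (lagrangian_subgradient mu_gt0 gx Fxi).
apply: (slater_exact_penalty g_convex s0 gzs normal).
have Bxi := HB _ _ _ xM lamM Fxi.
have : dotv xi xi <= n%:R * B ^+ 2.
  apply: (le_trans (dotv_le_sqr_norm _)).
  by rewrite ler_wpM2l// ler_pXn2r// nnegrE.
have : dotv (x t - z) (x t - z) <= n%:R * (M + `|z|) ^+ 2.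
  apply: (le_trans (dotv_le_sqr_norm _)); rewrite ler_wpM2l//.
  rewrite ler_pXn2r ?nnegrE// ?addr_ge0// ?(le_trans _ xM)//.
  by apply: (le_trans (ler_normB _ _)); rewrite lerD2r.
have := dotv_le_mean (xi - v) (x t - z).
have -> : (Q / s + 1) * s = Q + s by field; rewrite gt_eqF.
rewrite /Q in Q0 *; lra.
Qed.
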